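(* Let $m\ge 1$, $0\le r<m$ and $\ell\ge 0$ be integers, and let $\delta>0$ be fixed. Let $S\subset\{1,2,\ldots,n\}$ be a Sidon set with $|S|=n^{1/2}+O(n^{1/2-\delta})$. Then, as $n\to\infty$, $$\sum_{\substack{a\in S\\ a\equiv r\ (\mathrm{mod}\ m)}} a^\ell=\frac{1}{m(\ell+1)}n^{\ell+1/2}+o\left(n^{\ell+1/2}\right).$$ Explicitly: for every $K>0$ and every $\eta>0$ there is $n_0$ (depending on $m,r,\ell,\delta,K,\eta$) such that for every integer $n\ge n_0$ and every Sidon set $S\subset\{1,\ldots,n\}$ with $\big||S|-n^{1/2}\big|\le K n^{1/2-\delta}$, one has $$\left|\sum_{\substack{a\in S\\ a\equiv r\ (\mathrm{mod}\ m)}} a^\ell-\frac{1}{m(\ell+1)}n^{\ell+1/2}\right|\le\eta\, n^{\ell+1/2}.$$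
   Context: A set $S\subset\mathbb{Z}$ is a Sidon set if all sums $a+b$, with $(a,b)\in S^2$ regarded as unordered pairs (with $a=b$ allowed), are distinct; i.e. $a+b=c+d$ with $a,b,c,d\in S$ implies $\{a,b\}=\{c,d\}$. *)

(* Defs.v *)
From HB Require Import structures.
From mathcomp Require Import all_boot all_order all_algebra.
From mathcomp Require Import finmap.
From mathcomp Require Import all_classical all_reals all_analysis.

Set Implicit Arguments.
Unset Strict Implicit.
Unset Printing Implicit Defensive.
Import Order.TTheory GRing.Theory Num.Theory.
Local Open Scope classical_set_scope.
Local Open Scope ring_scope.

(* Repetitions among a, b, c, d are allowed, so {a, b} may be a singleton. *)
Definition sidon (S : set int) : Prop :=
  forall a b c d : int, S a -> S b -> S c -> S d ->
    a + b = c + d -> [set a; b] = [set c; d].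

(* Main.v *)
Require Import Defs.
From HB Require Import structures.
From mathcomp Require Import all_boot all_order all_algebra.
From mathcomp Require Import finmap.
From mathcomp Require Import all_classical all_reals all_analysis.
From mathcomp Require Import zify ring lra.

Set Implicit Arguments.
Unset Strict Implicit.
Unset Printing Implicit Defensive.
Import Order.TTheory GRing.Theory Num.Theory.
Local Open Scope classical_set_scope.
Local Open Scope ring_scope.

(** Let [A x] count the elements of [S] in the progression
    [x, x - m, ..., x - (u - 1) m], and let [w = sqrt n].  Each nonzero
    difference occurs at most once in a Sidon set, so
    [\sum_x A x ^ 2 <= u |S| + u ^ 2], which is essentially the value forced by
    Cauchy-Schwarz when [|S|] is close to [w] and [u m] is a small proportion
    of [n].  Hence [\sum_x (A x - u / w) ^ 2] is a small multiple of [u ^ 2].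
    Pairing [A] with a weight [f] supported on [x = r (mod m)] then gives
    [\sum_x f x * A x = u / w * \sum_x f x + o(u w n ^ l)], and, as
    [u m] is small compared with [n], the left-hand side is close to
    [u * \sum_(a in S, a = r (mod m)) a ^ l] for the weight [f x = x ^ l]. *)

(** * Sidon families and the moments of window counts *)

(** Indexing by a type turns sums over the set into finite-type sums with natural-number values;
    injectivity of [v] is built in. *)
Definition sidon_family (T : Type) (v : T -> nat) : Prop :=
  forall a b c d : T, (v a + v b = v c + v d)%N ->
    (a = c /\ b = d) \/ (a = d /\ b = c).

Lemma sidon_family_inj (T : Type) (v : T -> nat) : sidon_family v -> injective v.
Proof. by move=> hv a b ab; case: (hv a a b b); rewrite ?ab // => -[]. Qed.

Lemma card_sidon_shift (T : finType) (v : T -> nat) (m j k : nat) :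
  sidon_family v -> (0 < m)%N ->
  (\sum_(a : T) \sum_(b : T) (v a + j * m == v b + k * m)%N
    <= if j == k then #|T| else 1)%N.
Proof.
move=> hv m0; have vI := sidon_family_inj hv.
(* For [j != k] the equation prescribes a nonzero difference [v a - v b]. *)
have [->|jk] := eqVneq j k.
  rewrite -sum1_card leq_sum // => a _.
  rewrite (bigD1 a) //= eqxx big1 // => b ba.
  by rewrite eqn_add2r (inj_eq vI) eq_sym (negbTE ba).
rewrite pair_bigA /= -big_mkcond /= sum1_card.
apply/card_le1_eqP => -[a b] [c d]; rewrite /in_mem /= => /eqP h1 /eqP h2.
have ab : (v a + v d = v c + v b)%N by lia.
(* The other alternative, [a = b], would force [j * m = k * m]. *)
case: (hv _ _ _ _ ab) => [[-> ->] //|[e _]].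
by move: h1; rewrite e; nia.
Qed.

(** For each shift [j], the choice [k = j] accounts for at most [#|T|] coincidences and every other
    [k] for at most one, so each [j] costs at most [#|T| + u]. *)
Lemma energy_le (T : finType) (v : T -> nat) (m u : nat) :
  sidon_family v -> (0 < m)%N ->
  (\sum_(a : T) \sum_(j < u) \sum_(b : T) \sum_(k < u)
     (v b + k * m == v a + j * m)%N <= u * #|T| + u * u)%N.
Proof.
move=> hv m0.
under eq_bigr => a _ do under eq_bigr => j _ do rewrite exchange_big.
rewrite exchange_big /=.
under eq_bigr => j _ do rewrite exchange_big.
have -> : (u * #|T| + u * u = \sum_(j < u) (#|T| + u))%N.
  by rewrite sum_nat_const card_ord mulnDr.
apply: leq_sum => j _ /=.
have -> : (#|T| + u = \sum_(k < u) ((if k == j then #|T| else 0) + 1))%N.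
  rewrite big_split /= sum_nat_const card_ord muln1 -big_mkcond /=.
  by rewrite big_pred1_eq.
apply: leq_sum => k _.
rewrite exchange_big /=; apply: leq_trans (card_sidon_shift _ _ hv m0) _.
by rewrite -val_eqE; case: ifP => _ //; rewrite leq_addr.
Qed.

(* The number of pairs [(a, j)] with [v a = x - j m] and [j < u]. *)
Definition window (R : realType) (T : finType) (v : T -> nat) (m u x : nat) : R :=
  \sum_(a : T) \sum_(j < u) ((v a + j * m == x)%N)%:R.

(** Double counting. It serves three choices of [F]: the constant 1 for the first moment, the window
    count itself for the second, and the weight for the final pairing. *)
Lemma window_dual (R : realType) (T : finType) (v : T -> nat) (m u N : nat)
    (F : nat -> R) :
  (forall a (j : 'I_u), (v a + j * m < N)%N) ->
  \sum_(x < N) F x * window R v m u x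
    = \sum_(a : T) \sum_(j < u) F (v a + j * m)%N.
Proof.
move=> hN; rewrite /window.
under eq_bigr => x _ do rewrite mulr_sumr.
rewrite exchange_big; apply: eq_bigr => a _ /=.
under eq_bigr => x _ do rewrite mulr_sumr.
rewrite exchange_big; apply: eq_bigr => j _ /=.
rewrite (bigD1 (Ordinal (hN a j))) //= eqxx mulr1 big1 ?addr0 // => x.
by rewrite -val_eqE /= eq_sym => /negbTE ->; rewrite mulr0.
Qed.

Lemma window_sum (R : realType) (T : finType) (v : T -> nat) (m u N : nat) :
  (forall a (j : 'I_u), (v a + j * m < N)%N) ->
  \sum_(x < N) window R v m u x = u%:R * #|T|%:R.
Proof.
move=> hN; under eq_bigr => x _ do rewrite -[window _ _ _ _ _]mul1r.
rewrite (window_dual (fun=> 1) hN).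
under eq_bigr => a _ do rewrite sumr_const card_ord.
by rewrite sumr_const -mulrnA natrM.
Qed.

Lemma window_sqr_sum (R : realType) (T : finType) (v : T -> nat) (m u N : nat) :
  sidon_family v -> (0 < m)%N ->
  (forall a (j : 'I_u), (v a + j * m < N)%N) ->
  \sum_(x < N) window R v m u x ^+ 2 <= u%:R * #|T|%:R + u%:R ^+ 2.
Proof.
move=> hv m0 hN; rewrite (window_dual (window R v m u) hN) /window.
rewrite -natrX -natrM -natrD.
apply: le_trans (_ : (\sum_(a : T) \sum_(j < u) \sum_(b : T) \sum_(k < u)
     (v b + k * m == v a + j * m)%N)%:R <= _); last first.
  by rewrite ler_nat; exact: energy_le.
rewrite natr_sum ler_sum // => a _; rewrite natr_sum ler_sum // => j _.
by rewrite natr_sum ler_sum // => b _; rewrite natr_sum.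
Qed.

Lemma window_variance (R : realType) (T : finType) (v : T -> nat) (m u N : nat)
    (c : R) :
  sidon_family v -> (0 < m)%N ->
  (forall a (j : 'I_u), (v a + j * m < N)%N) ->
  \sum_(x < N) (window R v m u x - c) ^+ 2
    <= u%:R * #|T|%:R + u%:R ^+ 2 - 2 * c * (u%:R * #|T|%:R) + N%:R * c ^+ 2.
Proof.
move=> hv m0 hN.
under eq_bigr => x _ do rewrite sqrrB.
rewrite big_split /= sumrB sumr_const card_ord sumrMnl -mulr_suml window_sum //.
rewrite -(mulr_natl (c ^+ 2)) -mulr_natl.
have := window_sqr_sum R hv m0 hN; lra.
Qed.

(** * Power sums over a residue class *)

(** After [x - y] is factored out, the cofactor is a sum of [l + 1] monomials [x ^ (l - i) * y ^ i],
    each between [y ^ l] and [x ^ l]. *)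
Lemma pow_diff_bounds (R : realType) (l : nat) (x y : R) : 0 <= y -> y <= x ->
  l.+1%:R * (x - y) * y ^+ l <= x ^+ l.+1 - y ^+ l.+1
    <= l.+1%:R * (x - y) * x ^+ l.
Proof.
move=> y0 yx; have x0 := le_trans y0 yx.
rewrite subrXX [l.+1%:R * _]mulrC -!mulrA; apply/andP; split;
  rewrite ler_wpM2l ?subr_ge0 //.
  rewrite mulr_natl -[X in _ *+ X]card_ord -sumr_const ler_sum // => i _.
  have il : (i <= l)%N by rewrite -ltnS.
  have -> : y ^+ l = y ^+ (l - i) * y ^+ i by rewrite -exprD subnK.
  by rewrite ler_wpM2r ?exprn_ge0 ?lerXn2r.
rewrite mulr_natl -[X in _ *+ X]card_ord -sumr_const ler_sum // => i _.
have il : (i <= l)%N by rewrite -ltnS.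
have -> : x ^+ l = x ^+ (l - i) * x ^+ i by rewrite -exprD subnK.
by rewrite ler_wpM2l ?exprn_ge0 ?lerXn2r.
Qed.

(** Induction on [q]: the range below [r] misses the class, and each further block of [m] integers
    meets it only in its first element. *)
Lemma sum_residue_class (R : realType) (m r q : nat) (F : nat -> R) : (r < m)%N ->
  \sum_(x < r + q * m | x == r %[mod m]) F x = \sum_(k < q) F (r + k * m)%N.
Proof.
move=> rm; rewrite -(big_mkord (fun x => x == r %[mod m])).
elim: q => [|q IH].
  rewrite mul0n addn0 big_ord0 big_nat_cond big1 // => x /andP[/andP[_ xr]].
  by rewrite !modn_small ?(ltn_trans xr rm) // => /eqP; lia.
rewrite (big_cat_nat (n := r + q * m)) //=; last by rewrite mulSn; lia.
rewrite IH big_ord_recr /=; congr (_ + _).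
rewrite big_ltn_cond ?mulSn; last by lia.
rewrite addnC modnMDl eqxx addnC big_nat_cond big1 ?addr0 // => x /andP[h].
rewrite (_ : x = (x - (r + q * m) + r) + q * m)%N; last by lia.
rewrite addnC modnMDl -[X in _ == X %[mod m]]add0n eqn_modDr mod0n modn_small; lia.
Qed.

(** The factor [n] on the left avoids the exponent [l - 1], so that [l = 0] fits the same
    formula. *)
Lemma pow_lipschitz (R : realType) (l : nat) (x y n : R) :
  0 <= y -> y <= x -> x <= n ->
  n * (x ^+ l - y ^+ l) <= l%:R * (x - y) * n ^+ l.
Proof.
move=> y0 yx xn; have x0 := le_trans y0 yx; have n0 := le_trans x0 xn.
case: l => [|l]; first by rewrite !expr0 subrr !mul0r mulr0.
have /andP[_ h] := pow_diff_bounds l y0 yx.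
apply: le_trans (_ : n * (l.+1%:R * (x - y) * n ^+ l) <= _).
  rewrite ler_wpM2l // (le_trans h) // ler_wpM2l ?lerXn2r //.
  by rewrite mulr_ge0 ?subr_ge0.
by rewrite exprS mulrCA.
Qed.

Lemma sum_ord_widen (R : realType) (N1 N2 : nat) (P : pred nat) (F : nat -> R) :
  (N1 <= N2)%N -> (forall x, 0 <= F x) ->
  \sum_(x < N1 | P x) F x <= \sum_(x < N2 | P x) F x.
Proof.
move=> N12 F0; rewrite -!(big_mkord P).
by rewrite [leRHS](big_cat_nat (n := N1)) //= lerDl sumr_ge0.
Qed.

(** Each term [(l + 1) * m * x ^ l] lies between the increments of the [(l + 1)]-th power over
    [[x - m, x]] and [[x, x + m]]; both telescope along the class. *)
Lemma sum_pow_residue_class (R : realType) (m r l n : nat) :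
  (r < m)%N -> (m <= n)%N ->
  `| l.+1%:R * m%:R * \sum_(x < n.+1 | x == r %[mod m]) x%:R ^+ l
     - n%:R ^+ l.+1 | <= l.+1%:R * m%:R * 2 ^+ l.+1 * n%:R ^+ l :> R.
Proof.
move=> rm mn; set T := \sum_(x < _ | _) _.
have m0 : (0 < m)%N by lia.
(* [r + q * m] is the largest member of the class up to [n]. *)
pose q := ((n - r) %/ m)%N.
have q1 : (r + q * m <= n)%N by rewrite -leq_subRL ?leq_divM; lia.
have q2 : (n < r + q.+1 * m)%N by rewrite -ltn_subLR ?ltn_ceil; lia.
have x0 (x : nat) : 0 <= x%:R ^+ l :> R by rewrite exprn_ge0.
have c0 : 0 <= l.+1%:R * m%:R :> R by rewrite mulr_ge0.
rewrite ler_distl; apply/andP; split.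
  (* Truncated subtraction makes the telescoping start at [r - m = 0]. *)
  have tele : (r + q * m - m)%:R ^+ l.+1
      <= l.+1%:R * m%:R * \sum_(k < q) (r + k * m)%:R ^+ l :> R.
    pose f k : R := (r + k * m - m)%:R ^+ l.+1.
    have -> : (r + q * m - m)%:R ^+ l.+1 = f q - f 0%N :> R.
      by rewrite /f mul0n addn0 (eqP (ltnW rm : (r - m == 0)%N)) expr0n subr0.
    rewrite -telescope_sumr // big_mkord mulr_sumr ler_sum // => k _.
    rewrite /f; have -> : (r + k.+1 * m - m = r + k * m)%N by rewrite mulSn; lia.
    set x := (r + k * m)%N.
    have xm : (x - m <= x)%N := leq_subr _ _.
    have /andP[_ h] := @pow_diff_bounds R l x%:R (x - m)%:R
      (ler0n _ _) ltac:(by rewrite ler_nat).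
    apply: (le_trans h); rewrite ler_wpM2r // ler_wpM2l //.
    by rewrite -natrB // ler_nat; lia.
  have hT : \sum_(k < q) (r + k * m)%:R ^+ l <= T.
    rewrite -(sum_residue_class q (fun x => x%:R ^+ l) rm).
    by apply: (@sum_ord_widen R _ _ (fun x => x == r %[mod m]) (fun x => x%:R ^+ l)); first lia.
  set y := (r + q * m - m)%N in tele.
  have yn : (y <= n)%N by rewrite /y; lia.
  have /andP[_ h] := @pow_diff_bounds R l n%:R y%:R
      (ler0n _ _) ltac:(by rewrite ler_nat).
  have h2 : l.+1%:R * (n%:R - y%:R) * n%:R ^+ l
      <= l.+1%:R * m%:R * 2 ^+ l.+1 * n%:R ^+ l :> R.
    rewrite ler_wpM2r // -mulrA ler_wpM2l //.
    (* The lower telescope stops one step early, at [r + q * m - m], so it may miss [n] by up to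
       [2 * m]. *)
    apply: le_trans (_ : m%:R * 2 <= _); last first.
      by rewrite ler_wpM2l // exprS ler_peMr // exprn_ege1 // ler1n.
    rewrite -natrM -natrB // ler_nat /y; move: q2; rewrite mulSn; lia.
  have := ler_wpM2l c0 hT; lra.
have tele : l.+1%:R * m%:R * \sum_(k < q.+1) (r + k * m)%:R ^+ l
    <= (r + q.+1 * m)%:R ^+ l.+1 :> R.
  pose f k : R := (r + k * m)%:R ^+ l.+1.
  apply: le_trans (_ : f q.+1 - f 0%N <= _); last first.
    by rewrite /f lerBlDr lerDl exprn_ge0.
  rewrite -telescope_sumr // big_mkord mulr_sumr ler_sum // => k _.
  rewrite /f; set x := (r + k * m)%N.
  have -> : (r + k.+1 * m = x + m)%N by rewrite /x mulSn; lia.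
  have /andP[h _] := @pow_diff_bounds R l (x + m)%:R x%:R
      (ler0n _ _) ltac:(by rewrite ler_nat leq_addr).
  by move: h; rewrite natrD addrAC subrr add0r.
have hT : T <= \sum_(k < q.+1) (r + k * m)%:R ^+ l.
  rewrite -(sum_residue_class q.+1 (fun x => x%:R ^+ l) rm).
  by apply: (@sum_ord_widen R _ _ (fun x => x == r %[mod m]) (fun x => x%:R ^+ l)); first lia.
have /andP[_ h] := @pow_diff_bounds R l (n + m)%:R n%:R
    (ler0n _ _) ltac:(by rewrite ler_nat leq_addr).
have h2 : (r + q.+1 * m)%:R ^+ l.+1 <= (n + m)%:R ^+ l.+1 :> R.
  by rewrite lerXn2r ?nnegrE // ler_nat mulSn; lia.
have h3 : (n + m)%:R ^+ l <= 2 ^+ l.+1 * n%:R ^+ l :> R.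
  apply: le_trans (_ : (2 * n%:R) ^+ l <= _).
    by rewrite lerXn2r ?nnegrE // ?mulr_ge0 // -natrM ler_nat; lia.
  by rewrite exprMn ler_wpM2r // exprS ler_peMl ?exprn_ge0 // ler1n.
have h4 := ler_wpM2l c0 hT; have h5 := ler_wpM2l c0 h3.
move: h; rewrite [X in l.+1%:R * (X - _)]natrD addrAC subrr add0r; lra.
Qed.

(** * Pairing with a bounded weight *)

(** Cauchy-Schwarz in additive form: the free parameter [lam] stands in for the square root of
    [V / N]. *)
Lemma pairing_bound (R : realType) (N : nat) (f A : nat -> R) (c B V lam : R) :
  0 < lam -> (forall x, 0 <= f x <= B) ->
  \sum_(x < N) (A x - c) ^+ 2 <= V ->
  `| \sum_(x < N) f x * A x - c * \sum_(x < N) f x |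
    <= B * ((V / lam + N%:R * lam) / 2).
Proof.
move=> lam0 fB hV; have B0 : 0 <= B by have /andP[] := fB 0%N; exact: le_trans.
rewrite mulr_sumr -sumrB.
apply: le_trans (ler_norm_sum _ _ _) _.
apply: le_trans (_ : \sum_(x < N) B * (((A x - c) ^+ 2 / lam + lam) / 2) <= _).
  apply: ler_sum => x _; have /andP[f0 fb] := fB x.
  rewrite [c * _]mulrC -mulrBr normrM (ger0_norm f0) ler_pM //.
  (* AM-GM: [2 |y| <= y ^ 2 / lam + lam] *)
  set y := A x - c; rewrite -(real_normK (num_real y)).
  have -> : (`|y| ^+ 2 / lam + lam) / 2 = `|y| + (`|y| - lam) ^+ 2 / lam / 2.
    by field; lra.
  by rewrite lerDl !divr_ge0 ?sqr_ge0 // ltW.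
rewrite -mulr_sumr ler_wpM2l // -mulr_suml ler_wpM2r ?invr_ge0 //.
rewrite big_split /= -mulr_suml sumr_const card_ord -(mulr_natl lam) lerD2r.
by rewrite ler_wpM2r // invr_ge0 ltW.
Qed.

(* The windows overhang [n]; cutting [x] off at [n] keeps the weight bounded by
   [n ^ l] there and Lipschitz along the residue class. *)
Definition trunc_pow (R : realType) (m r l n x : nat) : R :=
  if x == r %[mod m] then (minn x n)%:R ^+ l else 0.

Lemma trunc_pow_bounds (R : realType) (m r l n x : nat) :
  0 <= trunc_pow R m r l n x <= n%:R ^+ l.
Proof.
rewrite /trunc_pow; case: ifP => _; last by rewrite lexx exprn_ge0.
by rewrite exprn_ge0 //= lerXn2r ?nnegrE // ler_nat geq_minr.
Qed.

Lemma trunc_pow_sum (R : realType) (m r l n k : nat) :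
  0 <= \sum_(x < n.+1 + k) trunc_pow R m r l n x
       - \sum_(x < n.+1 | x == r %[mod m]) x%:R ^+ l
    <= k%:R * n%:R ^+ l.
Proof.
set T := \sum_(x < n.+1 | _) _.
rewrite -(big_mkord xpredT) (big_cat_nat (n := n.+1)) //=; last by lia.
have -> : \sum_(0 <= x < n.+1) trunc_pow R m r l n x = T.
  rewrite big_mkord /T [RHS]big_mkcond; apply: eq_bigr => x _ /=.
  by rewrite /trunc_pow (minn_idPl _) // -ltnS.
rewrite addrAC subrr add0r; apply/andP; split.
  by apply: sumr_ge0 => x _; have /andP[] := trunc_pow_bounds R m r l n x.
apply: le_trans (_ : \sum_(n.+1 <= x < n.+1 + k) n%:R ^+ l <= _).
  by apply: ler_sum => x _; have /andP[] := trunc_pow_bounds R m r l n x.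
by rewrite sumr_const_nat addKn mulr_natl.
Qed.

(** Shifting by [j * m] keeps the residue class and moves the truncated point by at most [u * m], so
    [pow_lipschitz] bounds each of the [#|T| * u] increments. *)
Lemma smeared_sum_bounds (R : realType) (T : finType) (v : T -> nat)
    (m u r l n : nat) : (forall a, (v a <= n)%N) ->
  0 <= n%:R * (\sum_a \sum_(j < u) trunc_pow R m r l n (v a + j * m)
               - u%:R * \sum_(a | v a == r %[mod m]) (v a)%:R ^+ l)
    <= #|T|%:R * u%:R * (l%:R * (u * m)%:R * n%:R ^+ l).
Proof.
move=> vn; set E := \sum_a _; set P := \sum_(a | _) _.
pose d a (j : 'I_u) : R := n%:R * (trunc_pow R m r l n (v a + j * m)
  - trunc_pow R m r l n (v a)).
have -> : n%:R * (E - u%:R * P) = \sum_a \sum_(j < u) d a j.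
  have -> : P = \sum_a trunc_pow R m r l n (v a).
    rewrite /P big_mkcond; apply: eq_bigr => a _.
    by rewrite /trunc_pow (minn_idPl (vn a)).
  rewrite mulr_sumr -sumrB mulr_sumr; apply: eq_bigr => a _.
  rewrite /d -mulr_sumr sumrB sumr_const card_ord.
  by rewrite -(mulr_natl (trunc_pow _ _ _ _ _ (v a))).
have d_bd a j : 0 <= d a j <= l%:R * (u * m)%:R * n%:R ^+ l.
  rewrite /d /trunc_pow addnC modnMDl; case: ifP => _; last first.
    by rewrite subrr mulr0 lexx !mulr_ge0 ?exprn_ge0.
  rewrite (minn_idPl (vn a)); set x := minn _ _.
  have ax : (v a <= x)%N by rewrite leq_min leq_addl vn.
  have xn : (x <= n)%N by rewrite geq_minr.
  rewrite mulr_ge0 ?subr_ge0 ?lerXn2r ?nnegrE ?ler_nat //=.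
  apply: le_trans (pow_lipschitz l _ _ _) _; rewrite ?ler_nat //.
  rewrite ler_wpM2r ?exprn_ge0 // ler_wpM2l // -natrB // ler_nat.
  have : (j * m <= u * m)%N by rewrite leq_mul2r ltnW ?orbT.
  by have : (x <= j * m + v a)%N := geq_minl _ _; lia.
apply/andP; split.
  by apply: sumr_ge0 => a _; apply: sumr_ge0 => j _; have /andP[] := d_bd a j.
apply: le_trans (_ : \sum_(a : T) \sum_(j < u)
    l%:R * (u * m)%:R * n%:R ^+ l <= _).
  by apply: ler_sum => a _; apply: ler_sum => j _; have /andP[] := d_bd a j.
under eq_bigr do rewrite sumr_const card_ord //=.
by rewrite sumr_const -mulrnA -[leLHS]mulr_natl natrM (mulrC u%:R).
Qed.

(** * The explicit estimate for a Sidon family *)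

(** With [P] the sum sought, [E] its smeared form and [W] the total weight, the error splits along
    [u * P], [E], [u / w * W] and [u * w * n ^ l / ((l + 1) * m)]; consecutive terms are compared in
    [hA], [hB] and [hC]. *)
Lemma sidon_power_sum_bound (R : realType) (T : finType) (v : T -> nat)
    (m u r l n : nat) (w tau : R) :
  sidon_family v -> (forall a, (v a <= n)%N) ->
  (r < m)%N -> (m <= n)%N -> (0 < u)%N -> (u * m < n)%N ->
  0 < w -> w ^+ 2 = n%:R -> 0 < tau -> #|T|%:R <= 2 * w ->
  #|T|%:R / u%:R + 2 * (1 - #|T|%:R / w) + (u * m).+1%:R / n%:R <= tau ^+ 2 ->
  `| \sum_(a | v a == r %[mod m]) (v a)%:R ^+ l
     - w * n%:R ^+ l / (l.+1%:R * m%:R) |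
   <= w * n%:R ^+ l
      * (3 / 2 * tau + (2 ^+ l.+1 + (u * m)%:R + 2 * l%:R * (u * m)%:R) / n%:R).
Proof.
move=> hv vn rm mn u0 umn w0 wn tau0 sw hvar; set s := #|T|%:R in sw hvar.
have m0 : (0 < m)%N by lia.
have n0 : 0 < n%:R :> R by rewrite ltr0n; lia.
have U0 : 0 < u%:R :> R by rewrite ltr0n.
have M0 : 0 < m%:R :> R by rewrite ltr0n.
have s0 : 0 <= s by exact: ler0n.
have B0 : 0 < n%:R ^+ l :> R by rewrite exprn_gt0.
have wD : w != 0 by rewrite gt_eqF.
have uD : u%:R != 0 :> R by rewrite gt_eqF.
set f := trunc_pow R m r l n; set N := (n.+1 + u * m)%N.
have N2n : (N <= 2 * n)%N by rewrite /N; lia.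
have hN a (j : 'I_u) : (v a + j * m < N)%N.
  rewrite /N addSn ltnS leq_add // leq_mul2r; apply/orP; right; exact: ltnW.
have := window_variance (u%:R / w) hv m0 hN.
set V := \sum_(_ < N) _ => hV.
(* As [N = n + u * m + 1] and [n = w ^ 2], the variance bound at [c = u / w] is exactly [u ^ 2]
   times the left side of [hvar]. *)
have hV2 : V <= (u%:R * tau) ^+ 2.
  apply: le_trans hV _; rewrite [leRHS]exprMn.
  apply: le_trans (ler_wpM2l (ltW (exprn_gt0 2 U0)) hvar).
  rewrite -/s /N -wn addSn -addnS natrD -wn le_eqVlt; apply/orP; left; apply/eqP.
  by field; rewrite wD uD.
(* For this [lam], [(u * tau) ^ 2 / lam] equals [u * tau * w] and [N * lam] is at most twice that,
   whence the factor [3 / 2]. *)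
have lam0 : 0 < tau * u%:R / w by rewrite divr_gt0 ?mulr_gt0.
have := pairing_bound lam0 (trunc_pow_bounds R m r l n) hV2.
rewrite (window_dual f hN).
have := smeared_sum_bounds R m u r l vn.
set E := \sum_a _; set P := \sum_(a | _) _ => /andP[E1 E2] E3.
have /andP[W1 W2] := trunc_pow_sum R m r l n (u * m).
have := sum_pow_residue_class R l rm mn.
move: W1 W2 E3; rewrite -/N -/f; set W := \sum_(x < N) f x.
set Z := \sum_(x < n.+1 | _) _ => W1 W2 E3 Zbd.
set um : R := (u * m)%:R in hvar E2 W2 *.
set B : R := n%:R ^+ l in B0 E2 E3 W2 Zbd *.
set k : R := l.+1%:R * m%:R in Zbd *.
have um0 : 0 <= um by exact: ler0n.
have k0 : 0 < k by rewrite mulr_gt0.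
have hA : `|E - u%:R * P| <= u%:R * (w * B) * (2 * l%:R * um / n%:R).
  rewrite ger0_norm; last by rewrite -(pmulr_rge0 _ n0).
  rewrite -(ler_pM2l n0); apply: (le_trans E2).
  have -> : n%:R * (u%:R * (w * B) * (2 * l%:R * um / n%:R))
     = (2 * w) * (u%:R * (l%:R * um * B)) by field; rewrite gt_eqF.
  by rewrite -mulrA ler_wpM2r // !mulr_ge0 // ltW.
have hB : `|E - u%:R / w * W| <= u%:R * (w * B) * (3 / 2 * tau).
  apply: (le_trans E3).
  have NR : N%:R <= 2 * n%:R :> R by rewrite -natrM ler_nat.
  have -> : u%:R * (w * B) * (3 / 2 * tau)
    = B * (((u%:R * tau) ^+ 2 / (tau * u%:R / w)
       + (2 * n%:R) * (tau * u%:R / w)) / 2).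
    by rewrite -wn; field; rewrite wD uD gt_eqF.
  rewrite ler_wpM2l ?(ltW B0) // ler_wpM2r // lerD2l.
  by rewrite ler_wpM2r // ltW.
have hC : `|u%:R / w * W - u%:R * (w * B / k)|
    <= u%:R * (w * B) * ((2 ^+ l.+1 + um) / n%:R).
  have -> : u%:R / w * W - u%:R * (w * B / k) = u%:R / w * (W - n%:R * B / k).
    by rewrite -wn; field; rewrite wD gt_eqF.
  have -> : u%:R * (w * B) * ((2 ^+ l.+1 + um) / n%:R)
     = u%:R / w * ((2 ^+ l.+1 + um) * B).
    by rewrite -wn; field; rewrite wD.
  rewrite normrM gtr0_norm ?divr_gt0 // ler_wpM2l ?divr_ge0 ?(ltW w0) //.
  have hZ : `|Z - n%:R * B / k| <= 2 ^+ l.+1 * B.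
    rewrite -(ler_pM2l k0) -{1}(gtr0_norm k0) -normrM.
    have -> : k * (Z - n%:R * B / k) = k * Z - n%:R ^+ l.+1.
      by rewrite exprS -/B; field; rewrite gt_eqF.
    by rewrite mulrA.
  move: hZ; rewrite !ler_distl => /andP[hZ1 hZ2]; have umB := mulr_ge0 um0 (ltW B0).
  by apply/andP; split; lra.
rewrite -(ler_pM2l U0) -{1}(gtr0_norm U0) -normrM.
move: hA hB hC.
have -> : u%:R * (P - w * B / k) = - (E - u%:R * P) + ((E - u%:R / w * W)
   + (u%:R / w * W - u%:R * (w * B / k))) by lra.
move=> hA hB hC; apply: le_trans (ler_normD _ _) _; rewrite normrN.
have := ler_normD (E - u%:R / w * W) (u%:R / w * W - u%:R * (w * B / k)).
set Q := `|_ + _| => hQ.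
have -> : u%:R * (w * B * (3 / 2 * tau + (2 ^+ l.+1 + um + 2 * l%:R * um) / n%:R))
  = u%:R * (w * B) * (3 / 2 * tau) + u%:R * (w * B) * ((2 ^+ l.+1 + um) / n%:R)
    + u%:R * (w * B) * (2 * l%:R * um / n%:R).
  by field; rewrite gt_eqF.
lra.
Qed.

(** * Choice of parameters and passage to large [n] *)

Lemma powR_eventually_ge (R : realType) (X alpha : R) : 0 < alpha ->
  exists n0 : nat, forall n : nat, (n0 <= n)%N -> X <= n%:R `^ alpha.
Proof.
move=> a0; have X0 : 0 <= `|X| `^ alpha^-1 by exact: powR_ge0.
exists (Num.bound (`|X| `^ alpha^-1)) => n hn.
apply: le_trans (ler_norm X) _.
rewrite -[leLHS]powRr1 // -[X in _ `^ X <= _](mulVf (lt0r_neq0 a0)) powRrM.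
apply: ge0_ler_powR; rewrite ?nnegrE ?(ltW a0) //.
by rewrite (le_trans (ltW (archi_boundP X0))) // ler_nat.
Qed.

Lemma fset_sidon_family (S : {fset int}) :
  sidon [set` S] -> (forall a : int, a \in S -> 0 <= a) ->
  sidon_family (fun a : S => `|val a|%N).
Proof.
move=> hS S0 a b c d e.
have aE (x : S) : `|val x|%N%:Z = val x by rewrite gez0_abs // S0 // fsvalP.
have e' : val a + val b = val c + val d.
  by move: (congr1 Posz e); rewrite !PoszD !aE.
have ab := hS _ _ _ _ (fsvalP a) (fsvalP b) (fsvalP c) (fsvalP d) e'.
(* Set equality is only used to place [a] in [{c, d}]; the equation between the sums then determines
   [b]. *)
have : [set val a; val b] (val a) by left.
rewrite ab => -[] /= h; [left|right]; split; try exact: val_inj;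
  by apply: val_inj => /=; move: e'; rewrite /= h; lia.
Qed.

Theorem mainTheorem7 (R : realType) (m r l : nat) (delta : R)
    (m_ge1 : (1 <= m)%N) (r_lt_m : (r < m)%N) (delta_gt0 : 0 < delta) :
  forall K eta : R, 0 < K -> 0 < eta ->
  exists n0 : nat, forall n : nat, (n0 <= n)%N ->
  forall S : {fset int},
    sidon [set` S] ->
    (forall a : int, a \in S -> 1 <= a <= n%:Z) ->
    `| #|` S|%fset%:R - n%:R `^ (1 / 2) | <= K * n%:R `^ (1 / 2 - delta) ->
    `| \sum_(a <- S | (a == r%:Z %[mod m%:Z])%Z) a%:~R ^+ l
       - 1 / (m%:R * (l%:R + 1)) * n%:R `^ (l%:R + 1 / 2) |
      <= eta * n%:R `^ (l%:R + 1 / 2).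
Proof.
move=> K eta K0 eta0.
(* The term [3 / 2 * tau] becomes [3 * eta / 8]; the terms in [2 ^ (l + 1) / n] and in [u * m / n]
   will each cost at most [eta / 8]. *)
pose tau := eta / 4; have tau0 : 0 < tau by rewrite divr_gt0.
have tau2 : 0 < tau ^+ 2 by rewrite exprn_gt0.
(* [beta] will bound [u * m / n]: the first entry serves the variance hypothesis, the second the
   final error. *)
pose beta := Num.min (tau ^+ 2 / 4) (eta / (16 * l.+1%:R)).
have beta0 : 0 < beta by rewrite lt_min !divr_gt0 ?mulr_gt0.
have [M mM Mbeta] : exists2 M, (m < M)%N & m%:R <= beta * M%:R.
  exists (maxn m.+1 (Num.bound (m%:R / beta))); first by rewrite leq_max leqnn.
  rewrite mulrC -ler_pdivrMr //.
  apply: le_trans (ltW (archi_boundP _)) _; first by rewrite divr_ge0 // ltW.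
  by rewrite ler_nat leq_max leqnn orbT.
(* [kap] bounds the relative error of [|S|] against [w]: 1 gives [|S| <= 2 * w], the other entry
   serves the variance. *)
pose kap := Num.min 1 (tau ^+ 2 / 8).
have kap0 : 0 < kap by rewrite lt_min ltr01 divr_gt0.
have half0 : 0 < 1 / 2 :> R by rewrite divr_gt0.
(* In turn these ensure [K / n ^ delta <= kap], [4 * M / w <= tau ^ 2 / 4] (a bound for [|S| / u]),
   [1 / n <= tau ^ 2 / 4] and [2 ^ (l + 1) / n <= eta / 8]. *)
have [n1 hn1] := powR_eventually_ge (K / kap) delta_gt0.
have [n2 hn2] := powR_eventually_ge (16 * M%:R / tau ^+ 2) half0.
have [n3 hn3] := powR_eventually_ge (4 / tau ^+ 2) (@ltr01 R).
have [n4 hn4] := powR_eventually_ge (8 * 2 ^+ l.+1 / eta) (@ltr01 R).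
exists (maxn M (maxn n1 (maxn n2 (maxn n3 n4)))) => n.
rewrite !geq_max => /and5P[Mn /hn1 {}hn1 /hn2 {}hn2 /hn3 {}hn3 /hn4 {}hn4].
move: hn3 hn4; rewrite !powRr1 // => hn3 hn4 S hS Sn.
have M0 : (0 < M)%N := leq_ltn_trans (leq0n m) mM.
have n0 : 0 < n%:R :> R by rewrite ltr0n (leq_trans M0 Mn).
have nD : n%:R != 0 :> R by rewrite gt_eqF.
rewrite !powRD ?nD ?implybT // powRN powR_mulrn //.
set w := n%:R `^ (1 / 2) in hn2 *.
have w0 : 0 < w by rewrite powR_gt0.
have wn : w ^+ 2 = n%:R.
  by rewrite expr2 -powRD ?nD ?implybT // (_ : 1 / 2 + 1 / 2 = 1) ?powRr1 //; lra.
rewrite cardfE => hs.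
pose v (a : S) := `|val a|%N.
have vE (a : S) : (v a)%:Z = val a.
  by rewrite gez0_abs //; have /andP[/(le_trans ler01)] := Sn _ (fsvalP a).
have hv : sidon_family v.
  by apply: fset_sidon_family hS _ => a /Sn /andP[/(le_trans ler01)].
have vn a : (v a <= n)%N by rewrite -lez_nat vE; have /andP[] := Sn _ (fsvalP a).
(* A fixed proportion of [n]: at least [n / (2 * M)], which outgrows [|S|], while
   [u * m <= beta * n] by the choice of [M]. *)
pose u := (n %/ M)%N.
have u0 : (0 < u)%N by rewrite divn_gt0.
have uM : (u * M <= n)%N := leq_divM n M.
have nuM : (n < u.+1 * M)%N := ltn_ceil n M0.
have n2uM : (n <= 2 * (u * M))%N.
  by rewrite mul2n -addnn (leq_trans (ltnW nuM)) // mulSn leq_add2r leq_pmull.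
have umn : (u * m < n)%N by rewrite (leq_trans _ uM) // ltn_pmul2l.
have mn : (m <= n)%N := ltnW (leq_trans mM Mn).
set s := #|_| in hs.
have hs2 : `|s%:R - w| <= kap * w.
  apply: (le_trans hs); rewrite mulrCA mulrC ler_wpM2r ?(ltW w0) //.
  by rewrite ler_pdivrMr ?powR_gt0 // mulrC -ler_pdivrMr.
have umn_beta : (u * m)%:R / n%:R <= beta.
  rewrite ler_pdivrMr // natrM.
  apply: le_trans (ler_wpM2l (ler0n R u) Mbeta) _.
  by rewrite mulrCA ler_wpM2l ?(ltW beta0) // -natrM ler_nat.
have kap1 : kap <= 1 by rewrite ge_min lexx.
have kap2 : kap <= tau ^+ 2 / 8 by rewrite ge_min lexx orbT.
have beta1 : beta <= tau ^+ 2 / 4 by rewrite ge_min lexx.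
have beta2 : beta * l.+1%:R <= eta / 16.
  apply: le_trans (_ : eta / (16 * l.+1%:R) * l.+1%:R <= _).
    by rewrite ler_wpM2r // ge_min lexx orbT.
  by rewrite invfM mulrA divfK // pnatr_eq0.
have sw : s%:R <= 2 * w.
  move: hs2; rewrite ler_distl => /andP[_ h].
  by have := ler_wpM2r (ltW w0) kap1; lra.
have h1 : s%:R / u%:R <= tau ^+ 2 / 4.
  rewrite ler_pdivrMr ?ltr0n //; apply: (le_trans sw).
  rewrite -(ler_pM2r w0) -mulrA -expr2 wn.
  have a1 : n%:R <= 2 * (u%:R * M%:R) :> R by rewrite -!natrM ler_nat.
  have a2 : 16 * M%:R <= tau ^+ 2 * w 
    by move: hn2; rewrite ler_pdivrMr // [w * _]mulrC.
  have := ler_wpM2l (ler0n R u) a2; lra.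
have h2 : 2 * (1 - s%:R / w) <= tau ^+ 2 / 4.
  have : 1 - kap <= s%:R / w.
    rewrite ler_pdivlMr //; move: hs2; rewrite ler_distl => /andP[h _]; lra.
  lra.
have h3 : (u * m).+1%:R / n%:R <= tau ^+ 2 / 2.
  have : 1 / n%:R <= tau ^+ 2 / 4.
    by rewrite ler_pdivrMr //; move: hn3; rewrite ler_pdivrMr //; lra.
  by rewrite -[(u * m).+1%:R]natr1 mulrDl; lra.
have := @sidon_power_sum_bound R _ v m u r l n w tau hv vn r_lt_m mn u0 umn w0 wn
  tau0 sw ltac:(rewrite -/s; lra).
have -> : \sum_(a <- S | (a == r%:Z %[mod m%:Z])%Z) (a%:~R : R) ^+ l
    = \sum_(a | v a == r %[mod m]) (v a)%:R ^+ l.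
  rewrite big_seq_fsetE; apply: eq_big => [a|a _]; last by rewrite -vE.
  by rewrite -vE !modz_nat eqz_nat.
rewrite -[l.+1%:R]natr1.
have -> : 1 / (m%:R * (l%:R + 1)) * (n%:R ^+ l * w)
   = w * n%:R ^+ l / ((l%:R + 1) * m%:R).
  by rewrite mul1r mulrC [m%:R * _]mulrC [w * _]mulrC.
move=> h; apply: (le_trans h); rewrite mulrC [w * _]mulrC ler_wpM2r //.
  by rewrite mulr_ge0 ?exprn_ge0 // ltW.
have h4 : 2 ^+ l.+1 / n%:R <= eta / 8.
  by rewrite ler_pdivrMr //; move: hn4; rewrite ler_pdivrMr //; lra.
have h5 : (u * m)%:R / n%:R * l.+1%:R <= eta / 16.
  by apply: le_trans beta2; rewrite ler_wpM2r.
have um0 : 0 <= (u * m)%:R / n%:R * l%:R :> R by rewrite !mulr_ge0 // invr_ge0 ltW.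
have um1 : 0 <= (u * m)%:R / n%:R :> R by rewrite mulr_ge0 // invr_ge0 ltW.
move: h5; rewrite -[l.+1%:R]natr1 mulrDr mulr1 => h5.
have -> : (2 ^+ l.+1 + (u * m)%:R + 2 * l%:R * (u * m)%:R) / n%:R
  = 2 ^+ l.+1 / n%:R + (u * m)%:R / n%:R
    + 2 * ((u * m)%:R / n%:R * l%:R) :> R by field.
by rewrite /tau; lra.
Qed.
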